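(* Let $A=[a_{rs}]$ be a strictly upper triangular binary $n\times n$ matrix with exactly two non-zero rows, those with indices $i<j$, such that the real Bott manifold $M(A)$ is orientable and no column of $A$ contains two entries equal to $1$. Let $k,l\ge 1$ and $i_1\ge 0$ be integers with $i_1+2k+2l\le n$. 1. Suppose that $a_{i,m}=1$ exactly for $m\in\{i_1+1,\dots,i_1+2k\}$ and $a_{j,r}=1$ exactly for $r\in\{i_1+2k+1,\dots,i_1+2k+2l\}$. Then $M(A)$ admits a Spin-structure if and only if either $l$ is even, or $l$ is odd and $j\notin\{i_1+1,\dots,i_1+2k\}$. 2. Suppose that $a_{j,m}=1$ exactly for $m\in\{i_1+1,\dots,i_1+2k\}$ and $a_{i,r}=1$ exactly for $r\in\{i_1+2k+1,\dots,i_1+2k+2l\}$. Then $M(A)$ has a Spin-structure.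
   Context: For a strictly upper triangular $n\times n$ matrix $A=[a_{ij}]$ with entries in $\{0,1\}$, the real Bott manifold $M(A)$ is the flat manifold $\mathbb{R}^n/\Gamma(A)$, where $\Gamma(A)\subset \operatorname{Isom}(\mathbb{R}^n)=O(n)\ltimes\mathbb{R}^n$ is the group generated by $s_1,\dots,s_n$, with $s_i=(\operatorname{diag}((-1)^{a_{i1}},\dots,(-1)^{a_{in}}),\ \tfrac12 e_i)$ and $e_i$ the $i$-th standard basis vector. $M(A)$ is orientable if and only if the sum of the entries in each row of $A$ is even. An oriented flat manifold $\mathbb{R}^n/\Gamma$, with $\Gamma\subset SO(n)\ltimes\mathbb{R}^n$ its fundamental group and $p$ the projection to $SO(n)$, has a Spin-structure if and only if there is a homomorphism $\epsilon:\Gamma\to\operatorname{Spin}(n)$ with $\lambda_n\epsilon=p$, where $\lambda_n:\operatorname{Spin}(n)\to SO(n)$ is the covering map; equivalently, its second Stiefel–Whitney class $w_2$ vanishes. *)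

(* Defs.v *)
From HB Require Import structures.
From mathcomp Require Import all_boot all_order all_algebra.
From mathcomp Require Import reals.
From mathcomp Require Import ring.

Set Implicit Arguments.
Unset Strict Implicit.
Unset Printing Implicit Defensive.

Import Order.TTheory GRing.Theory Num.Theory.
Local Open Scope ring_scope.

(******************************************************************************)
(* The isometry group O(n) \ltimes R^n: the pair (B, b) acts on R^n by        *)
(* v |-> B v + b.                                                             *)
(******************************************************************************)

Section Isometries.
Variables (R : realType) (n : nat).

Record isom := Isom {
  isom_pair :> 'M[R]_n * 'cV[R]_n;
  isom_pairP : isom_pair.1 *m isom_pair.1^T == 1%:M }.

HB.instance Definition _ := [isSub for isom_pair].
HB.instance Definition _ := [Choice of isom by <:].

Definition lin_part (g : isom) : 'M[R]_n := g.1.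
Definition trans_part (g : isom) : 'cV[R]_n := g.2.

Lemma lin_partK (g : isom) : lin_part g *m (lin_part g)^T = 1%:M.
Proof. exact/eqP/isom_pairP. Qed.

Lemma lin_partKV (g : isom) : (lin_part g)^T *m lin_part g = 1%:M.
Proof. exact/mulmx1C/lin_partK. Qed.

Lemma isom_eq (g h : isom) : lin_part g = lin_part h ->
  trans_part g = trans_part h -> g = h.
Proof.
move=> eq1 eq2; apply: val_inj; rewrite [LHS]surjective_pairing.
by rewrite [RHS]surjective_pairing; congr pair.
Qed.

Fact isom_one_subproof :
  (1%:M : 'M[R]_n, 0 : 'cV[R]_n).1 *m (1%:M : 'M[R]_n, 0 : 'cV[R]_n).1^T
    == 1%:M.
Proof. by rewrite trmx1 mulmx1. Qed.
Definition isom_one : isom := Isom isom_one_subproof.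

Fact isom_mul_subproof (g h : isom) :
  (lin_part g *m lin_part h, trans_part g + lin_part g *m trans_part h).1 *m
  (lin_part g *m lin_part h, trans_part g + lin_part g *m trans_part h).1^T
    == 1%:M.
Proof.
by rewrite /= trmx_mul mulmxA -(mulmxA (lin_part g)) !(lin_partK, mulmx1).
Qed.
Definition isom_mul (g h : isom) : isom := Isom (isom_mul_subproof g h).

Fact isom_inv_subproof (g : isom) :
  ((lin_part g)^T, - ((lin_part g)^T *m trans_part g)).1 *m
  ((lin_part g)^T, - ((lin_part g)^T *m trans_part g)).1^T == 1%:M.
Proof. by rewrite /= trmxK lin_partKV. Qed.
Definition isom_inv (g : isom) : isom := Isom (isom_inv_subproof g).

Fact isom_mulA : associative isom_mul.
Proof.
move=> f g h; apply: isom_eq; rewrite /lin_part /trans_part /=.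
  by rewrite mulmxA.
by rewrite -/(lin_part f) mulmxDr mulmxA addrA.
Qed.

Fact isom_mul1 : left_id isom_one isom_mul.
Proof.
by move=> g; apply: isom_eq; rewrite /lin_part /trans_part /= ?mul1mx ?add0r.
Qed.

Fact isom_mulr1 : right_id isom_one isom_mul.
Proof.
by move=> g; apply: isom_eq; rewrite /lin_part /trans_part /=
  ?mulmx1 ?mulmx0 ?addr0.
Qed.

Fact isom_mulV : left_inverse isom_one isom_inv isom_mul.
Proof.
by move=> g; apply: isom_eq; [exact: lin_partKV | exact: addNr].
Qed.

Fact isom_mulrV : right_inverse isom_one isom_inv isom_mul.
Proof.
move=> g; apply: isom_eq; first exact: lin_partK.
rewrite [LHS]/(trans_part g + lin_part g *m - ((lin_part g)^T *m trans_part g)).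
by rewrite mulmxN mulmxA lin_partK mul1mx; exact: subrr.
Qed.

HB.instance Definition _ :=
  isGroup.Build isom isom_mulA isom_mul1 isom_mulr1 isom_mulV isom_mulrV.

End Isometries.

Inductive subgroup_gen (G : groupType) (I : Type) (s : I -> G) : G -> Prop :=
| gen_one : subgroup_gen s 1%g
| gen_in i : subgroup_gen s (s i)
| gen_mul g h : subgroup_gen s g -> subgroup_gen s h -> subgroup_gen s (g * h)%g
| gen_inv g : subgroup_gen s g -> subgroup_gen s (g^-1)%g.

(******************************************************************************)
(* The real Clifford algebra with e_i^2 = -1 and e_i e_j = - e_j e_i, on its  *)
(* standard basis: x : clifford R n stands for \sum_S x S *: e_S, where e_S   *)
(* is the product of the e_i, i \in S, by increasing i. Reordering            *)
(* e_S e_T costs one sign per pair (i, j) \in S x T with j < i, and           *)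
(* cancelling the squares one per pair with j = i.                            *)
(******************************************************************************)

Section Clifford.
Variables (R : realType) (n : nat).
Implicit Types S T U : {set 'I_n}.

Definition symd S T : {set 'I_n} := (S :\: T) :|: (T :\: S).

Definition csign S T : bool :=
  odd #|[set p : 'I_n * 'I_n | [&& p.1 \in S, p.2 \in T & (p.2 <= p.1)%N]]|.

Definition clifford := {ffun {set 'I_n} -> R^o}.
HB.instance Definition _ := GRing.Lmodule.on clifford.
Implicit Types x y z : clifford.

Definition cbase S : clifford := [ffun T => (T == S)%:R].

(* The coefficient of e_U collects the pairs (S, T) with symd S T = U, i.e.   *)
(* T = symd S U.                                                              *)
Definition cmul x y : clifford :=
  [ffun U => \sum_S (-1) ^+ csign S (symd S U) * x S * y (symd S U)].

Lemma in_symd S T i : (i \in symd S T) = (i \in S) (+) (i \in T).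
Proof. by rewrite !inE; case: (i \in S); case: (i \in T). Qed.

Lemma symdA S T U : symd S (symd T U) = symd (symd S T) U.
Proof. by apply/setP=> i; rewrite !in_symd addbA. Qed.

Lemma symdC S T : symd S T = symd T S.
Proof. by apply/setP=> i; rewrite !in_symd addbC. Qed.

Lemma symd0 S : symd set0 S = S.
Proof. by apply/setP=> i; rewrite !in_symd inE. Qed.

Lemma symdd S : symd S S = set0.
Proof. by apply/setP=> i; rewrite !in_symd inE addbb. Qed.

Lemma symdK S : involutive (symd S).
Proof. by move=> T; rewrite symdA symdd symd0. Qed.

Lemma csignE S T : csign S T =
  \big[addb/false]_(p : 'I_n * 'I_n)
     [&& p.1 \in S, p.2 \in T & (p.2 <= p.1)%N].
Proof.
rewrite /csign -sum1_card big_mkcond (big_morph odd oddD (erefl _)).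
by apply: eq_bigr => p _; rewrite inE; case: ifP.
Qed.

Lemma csignDl S T U : csign (symd S T) U = csign S U (+) csign T U.
Proof.
rewrite !csignE -big_split; apply: eq_bigr => p _ /=.
by rewrite in_symd andb_addl.
Qed.

Lemma csignDr S T U : csign S (symd T U) = csign S T (+) csign S U.
Proof.
rewrite !csignE -big_split; apply: eq_bigr => p _ /=.
by rewrite in_symd andb_addl andb_addr.
Qed.

Lemma csign0l S : csign set0 S = false.
Proof. by rewrite csignE big1 // => p _; rewrite inE. Qed.

Lemma csign0r S : csign S set0 = false.
Proof. by rewrite csignE big1 // => p _; rewrite inE andbF. Qed.

Fact cmulA : associative cmul.
Proof.
move=> x y z; apply/ffunP=> U; rewrite !ffunE.
under eq_bigr do rewrite ffunE big_distrr /=.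
under [RHS]eq_bigr do rewrite ffunE big_distrr big_distrl /=.
rewrite [RHS]exchange_big /=; apply: eq_bigr => S _.
rewrite [RHS](reindex_inj (inv_inj (symdK S))) /=; apply: eq_bigr => T _.
rewrite symdK -symdA [symd T (symd S U)]symdA [symd T S]symdC -symdA.
rewrite !(csignDl, csignDr) !signr_addb.
by case: (csign S T); rewrite ?expr0 ?expr1; ring.
Qed.

Fact cmul1 : left_id (cbase set0) cmul.
Proof.
move=> x; apply/ffunP=> U; rewrite !ffunE (bigD1 set0) //= big1 => [|S nzS].
  by rewrite ffunE eqxx csign0l symd0 !mul1r addr0.
by rewrite ffunE (negPf nzS) mulr0 mul0r.
Qed.

Fact cmulr1 : right_id (cbase set0) cmul.
Proof.
move=> x; apply/ffunP=> U; rewrite !ffunE (bigD1 U) //= big1 => [|S nzS].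
  by rewrite symdd ffunE eqxx csign0r mul1r mulr1 addr0.
rewrite ffunE; case: eqP => [SU0|_]; last by rewrite mulr0.
by case/eqP: nzS; rewrite -[U](symdK S) SU0 symdC symd0.
Qed.

Fact cmulDl : left_distributive cmul +%R.
Proof.
move=> x y z; apply/ffunP=> U; rewrite !ffunE -big_split /=.
by apply: eq_bigr => S _; rewrite ffunE mulrDr mulrDl.
Qed.

Fact cmulDr : right_distributive cmul +%R.
Proof.
move=> x y z; apply/ffunP=> U; rewrite !ffunE -big_split /=.
by apply: eq_bigr => S _; rewrite ffunE mulrDr.
Qed.

Fact cone_neq0 : cbase set0 != 0.
Proof. by apply/eqP=> /ffunP/(_ set0)/eqP; rewrite !ffunE eqxx oner_eq0. Qed.

HB.instance Definition _ := GRing.Zmodule_isNzRing.Build clifford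
  cmulA cmul1 cmulr1 cmulDl cmulDr cone_neq0.

Fact cscaleAl (a : R) x y : a *: (x * y) = (a *: x) * y.
Proof.
apply/ffunP=> U; rewrite !ffunE [LHS]big_distrr.
by apply: eq_bigr => S _ /=; rewrite ffunE /GRing.scale /=; ring.
Qed.

HB.instance Definition _ := GRing.Lmodule_isLalgebra.Build R clifford cscaleAl.

Fact cscaleAr (a : R) x y : a *: (x * y) = x * (a *: y).
Proof.
apply/ffunP=> U; rewrite !ffunE [LHS]big_distrr.
by apply: eq_bigr => S _ /=; rewrite ffunE /GRing.scale /=; ring.
Qed.

HB.instance Definition _ := GRing.Lalgebra_isAlgebra.Build R clifford cscaleAr.

Lemma cbaseM S T : cbase S * cbase T = (-1) ^+ csign S T *: cbase (symd S T).
Proof.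
apply/ffunP=> U; rewrite !ffunE (bigD1 S) //= big1 => [|S' neqS].
  rewrite !ffunE eqxx mulr1 addr0 (can2_eq (symdK S) (symdK S)).
  by case: eqP => [->|_]; rewrite ?symdK // !mulr0 /GRing.scale /= mulr0.
by rewrite ffunE (negPf neqS) mulr0 mul0r.
Qed.

Lemma cbase_sum x : x = \sum_S x S *: cbase S.
Proof.
apply/ffunP=> U; rewrite sum_ffunE (bigD1 U) //= big1 => [|S nSU].
  by rewrite !ffunE eqxx addr0 /GRing.scale /= mulr1.
by rewrite !ffunE eq_sym (negPf nSU) /GRing.scale /= mulr0.
Qed.

Definition cvec (v : 'cV[R]_n) : clifford := \sum_i v i 0 *: cbase [set i].

Lemma cvec_is_linear : linear cvec.
Proof.
move=> a v w; rewrite /cvec scaler_sumr -big_split.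
by apply: eq_bigr => i _; rewrite !mxE scalerDl scalerA.
Qed.

HB.instance Definition _ :=
  GRing.isLinear.Build R 'cV[R]_n clifford *:%R cvec cvec_is_linear.

Lemma cvec1 v i : cvec v [set i] = v i 0.
Proof.
rewrite sum_ffunE (bigD1 i) //= big1 => [|j nji].
  by rewrite !ffunE eqxx addr0 /GRing.scale /= mulr1.
rewrite !ffunE (inj_eq set1_inj) eq_sym (negPf nji).
by rewrite /GRing.scale /= mulr0.
Qed.

Lemma cvec_delta i : cvec (delta_mx i 0) = cbase [set i].
Proof.
rewrite /cvec (bigD1 i) //= big1 => [|j nji].
  by rewrite mxE !eqxx scale1r addr0.
by rewrite mxE (negPf nji) scale0r.
Qed.

Lemma csign1 i j : csign [set i] [set j] = (j <= i)%N.
Proof.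
rewrite csignE (bigD1 (i, j)) //= !inE !eqxx big1 ?addbF // => -[i' j'] /=.
by rewrite !inE xpair_eqE; case: eqP; case: eqP.
Qed.

Lemma cbase_anticomm i j :
  cbase [set i] * cbase [set j] + cbase [set j] * cbase [set i]
    = - ((i == j)%:R *+ 2).
Proof.
rewrite !cbaseM !csign1 (symdC [set j]).
have [<-|neq_ij] := eqVneq i j.
  by rewrite leqnn symdd expr1 scaleN1r -opprD.
rewrite mul0rn oppr0 -scalerDl; move: neq_ij; rewrite -val_eqE /=.
by case: ltngtP => // _ _; rewrite ?expr0 ?expr1 ?subrr ?addNr scale0r.
Qed.

Lemma cvecM v w :
  cvec v * cvec w =
  \sum_i \sum_j (v i 0 * w j 0) *: (cbase [set i] * cbase [set j]).
Proof.
rewrite /cvec big_distrl; apply: eq_bigr => i _; rewrite big_distrr.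
by apply: eq_bigr => j _; rewrite /= -scalerAl -scalerAr scalerA.
Qed.

Lemma cvec_anticomm v w :
  cvec v * cvec w + cvec w * cvec v = - ((\sum_i v i 0 * w i 0) *+ 2)%:A.
Proof.
rewrite [cvec w * _]cvecM exchange_big cvecM -big_split -sumrMnl scaler_suml.
rewrite -sumrN; apply: eq_bigr => i _; rewrite -big_split (bigD1 i) //= big1.
  rewrite addr0 (mulrC (w i 0)) -scalerDr cbase_anticomm eqxx.
  by rewrite scalerN -scalerMnr -scalerMnl.
move=> j /negPf nji.
rewrite (mulrC (w j 0)) -scalerDr cbase_anticomm eq_sym nji.
by rewrite mul0rn oppr0 scaler0.
Qed.

Lemma cvec_sqr v : cvec v * cvec v = - (\sum_i v i 0 ^+ 2)%:A.
Proof.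
have:= cvec_anticomm v v; rewrite -mulr2n -scalerMnl -mulNrn -!scaler_nat.
by move/(scalerI (_ : 2%:R != 0 :> R)); apply; rewrite pnatr_eq0.
Qed.

(* The anti-automorphism fixing the vectors: reversing a product of k         *)
(* generators takes k (k - 1) / 2 transpositions.                             *)
Definition crev x : clifford :=
  [ffun S : {set 'I_n} => (-1) ^+ 'C(#|S|, 2) * x S].

Lemma odd_bin2D a b :
  odd 'C(a + b, 2) = odd 'C(a, 2) (+) odd 'C(b, 2) (+) odd (a * b).
Proof.
elim: a => [|a IHa]; first by rewrite bin0n addbF.
rewrite mulSn addSn !binS !bin1 !oddD IHa.
case: (odd 'C(a, 2)); case: (odd 'C(b, 2)); case: (odd (a * b)).
all: by case: (odd a); case: (odd b).
Qed.

Lemma csignC S T : csign S T (+) csign T S =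
  odd 'C(#|S|, 2) (+) odd 'C(#|T|, 2) (+) odd 'C(#|symd S T|, 2).
Proof.
have -> : csign S T (+) csign T S = odd (#|S| * #|T|) (+) odd #|S :&: T|.
  have sw_inj : injective (fun p : 'I_n * 'I_n => (p.2, p.1)).
    by move=> [a b] [c d] [-> ->].
  rewrite !csignE [X in _ (+) X](reindex_inj sw_inj) -big_split /=.
  rewrite -cardsX -!sum1_card !(big_morph odd oddD (erefl : odd 0 = false)).
  rewrite [X in _ = X (+) _]big_mkcond [X in _ = _ (+) X]big_mkcond /=.
  have -> : \big[addb/false]_(i : 'I_n) (if i \in S :&: T then true else false)
    = \big[addb/false]_(p : 'I_n * 'I_n)
        [&& p.1 == p.2, p.1 \in S & p.2 \in T].
    rewrite -(pair_bigA _ (fun i j => [&& i == j, i \in S & j \in T])) /=.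
    apply: eq_bigr => i _; rewrite (bigD1 i) //= big1 => [|j].
      by rewrite eqxx addbF inE; case: ifP.
    by rewrite eq_sym => /negPf ->.
  rewrite -big_split; apply: eq_bigr => -[i j] _ /=.
  rewrite !inE /= -val_eqE /=.
  by case: (i \in S); case: (j \in T); rewrite ?andbF //=; case: ltngtP.
rewrite -(cardsID T S) -[#|T|](cardsID S T) [T :&: S]setIC /symd cardsU.
rewrite (_ : (S :\: T) :&: (T :\: S) = set0) ?cards0 ?subn0; last first.
  by apply/setP=> i; rewrite !inE; case: (i \in S); rewrite ?andbF.
rewrite !odd_bin2D !(oddM, oddD); move: 'C(_, _) 'C(_, _) 'C(_, _) => p q r.
move: #|_ :&: _| #|_ :\: _| #|_ :\: _| => a b c.
case: (odd p); case: (odd q); case: (odd r).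
all: by case: (odd a); case: (odd b); case: (odd c).
Qed.

Lemma crevM x y : crev (x * y) = crev y * crev x.
Proof.
apply/ffunP=> U; rewrite !ffunE big_distrr /=.
rewrite [RHS](reindex_inj (inv_inj (@symdK U))) /=; apply: eq_bigr => S _.
set T := symd U S.
have TU : symd T U = S by rewrite /T symdC symdK.
have SU : symd S U = T by rewrite symdC.
rewrite !ffunE TU SU.
have ST : symd S T = U by rewrite -SU symdK.
have := csignC S T; rewrite ST => /(canRL (addbK _)) ->.
rewrite !signr_addb !signr_odd.
have sqr1 m : (-1) ^+ m * (-1) ^+ m = 1 :> R.
  by rewrite -exprMn mulrNN mulr1 expr1n.
rewrite -!mulrA mulrCA 2!(mulrCA ((-1) ^+ 'C(#|U|, 2))) mulrA.
rewrite [in LHS](mulrA ((-1) ^+ 'C(#|U|, 2))) sqr1.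
by ring.
Qed.

Lemma crev_cvec v : crev (cvec v) = cvec v.
Proof.
apply/ffunP=> S; rewrite ffunE sum_ffunE big_distrr /=.
apply: eq_bigr => i _; rewrite !ffunE.
case: eqP => [->|_]; first by rewrite cards1 bin_small // mul1r.
by rewrite /GRing.scale /= !mulr0.
Qed.

Lemma crev1 : crev 1 = 1.
Proof.
apply/ffunP=> S; rewrite !ffunE.
by case: eqP => [->|_]; rewrite ?mulr0 // cards0 bin_small // mul1r.
Qed.

Definition unit_vec (v : 'cV[R]_n) : Prop := \sum_i v i 0 ^+ 2 = 1.

Definition in_spin x : Prop :=
  exists s : seq 'cV[R]_n,
    [/\ forall v, v \in s -> unit_vec v, ~~ odd (size s)
      & x = \prod_(v <- s) cvec v].

(* The matrix of v |-> x v (crev x), an endomorphism of R^n when x \in        *)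
(* Spin(n) (lemma spin_coverE); on Spin(n), crev is the inverse.              *)
Definition spin_cover x : 'M[R]_n :=
  \matrix_(i, j) (x * cvec (delta_mx j 0) * crev x) [set i].

Lemma crev_prod (s : seq 'cV[R]_n) : (forall v, v \in s -> unit_vec v) ->
  (\prod_(v <- s) cvec v) * crev (\prod_(v <- s) cvec v)
    = (-1) ^+ size s :> clifford.
Proof.
elim: s => [|v s IHs] unit_s; first by rewrite big_nil crev1 mulr1.
have unit_v : unit_vec v by apply: unit_s; rewrite mem_head.
rewrite big_cons crevM crev_cvec mulrA -(mulrA (cvec v)) IHs; last first.
  by move=> w ws; apply: unit_s; rewrite inE ws orbT.
rewrite /= exprS mulN1r -signr_odd; case: (odd _).
  by rewrite expr1 mulrN1 mulNr cvec_sqr unit_v scale1r.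
by rewrite expr0 mulr1 cvec_sqr unit_v scale1r.
Qed.

Lemma in_spinV x : in_spin x -> x * crev x = 1.
Proof.
by case=> s [unit_s even_s ->]; rewrite crev_prod // -signr_odd (negPf even_s).
Qed.

Lemma spin_coverE x v : in_spin x ->
  x * cvec v * crev x = cvec (spin_cover x *m v).
Proof.
move=> [s [_ _ defx]].
have conj_vec w : exists u, x * cvec w * crev x = cvec u.
  rewrite {}defx; elim: s => [|a s [u IHu]].
    by exists w; rewrite big_nil crev1 mul1r mulr1.
  rewrite big_cons crevM crev_cvec.
  have -> b : cvec a * b * cvec w * (crev b * cvec a) =
    cvec a * (b * cvec w * crev b) * cvec a by rewrite !mulrA.
  rewrite IHu; have /(canRL (addrK _)) -> := cvec_anticomm a u.
  rewrite mulrBl -mulrA cvec_sqr mulNr mulrN opprK mulr_algl mulr_algr.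
  by rewrite -linearZ /= -linearZ -linearN -linearD; eexists.
pose f (w : 'cV[R]_n) : 'cV[R]_n := \col_i (x * cvec w * crev x) [set i].
have fE w : x * cvec w * crev x = cvec (f w).
  have [u fu] := conj_vec w.
  by rewrite fu; congr cvec; apply/colP=> i; rewrite mxE fu cvec1.
rewrite fE; congr cvec; apply/colP=> i; rewrite !mxE.
rewrite {1}/cvec mulr_sumr mulr_suml sum_ffunE; apply: eq_bigr => j _.
by rewrite -cvec_delta mxE -scalerAr -scalerAl ffunE mulrC.
Qed.

End Clifford.

(******************************************************************************)
(* The flat manifold R^n / G is represented by its fundamental group G, a     *)
(* predicate on isometries; M(A) is R^n / bott_group R A.                     *)
(******************************************************************************)

Section Bott.
Variables (R : realType) (n : nat).
Implicit Types (A : 'M[bool]_n) (G : isom R n -> Prop).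

(* The indices {a, ..., b}, numbered from 1: the ordinal m stands for m + 1.  *)
Definition icc (a b : nat) : {set 'I_n} := [set m : 'I_n | (a <= m.+1 <= b)%N].

Definition strictly_upper A : Prop := forall r s : 'I_n, A r s -> (r < s)%N.

Definition bott_diag A (i : 'I_n) : 'M[R]_n :=
  diag_mx (\row_j (-1) ^+ A i j).

Fact bott_gen_subproof A i :
  (bott_diag A i, 2^-1 *: delta_mx i 0 : 'cV[R]_n).1 *m
  (bott_diag A i, 2^-1 *: delta_mx i 0 : 'cV[R]_n).1^T == 1%:M.
Proof.
rewrite /= tr_diag_mx mulmx_diag; apply/eqP/matrixP=> a b.
by rewrite !mxE -signr_addb addbb.
Qed.

Definition bott_gen A i : isom R n := Isom (bott_gen_subproof A i).

Definition bott_group A : isom R n -> Prop := subgroup_gen (bott_gen A).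

Definition orientable G : Prop := forall g, G g -> \det (lin_part g) = 1.

(* A homomorphism eps : G -> Spin(n) lifting the holonomy G -> SO(n); the     *)
(* values of eps outside G are irrelevant.                                    *)
Definition has_spin_structure G : Prop :=
  exists eps : isom R n -> clifford R n,
    [/\ forall g, G g -> in_spin (eps g),
        forall g h, G g -> G h -> eps (g * h)%g = eps g * eps h
      & forall g, G g -> spin_cover (eps g) = lin_part g].

End Bott.

Arguments bott_group R {n} A.

(* Main.v *)
(* Let S_i, S_j be the supports of the two rows and e_S the product of the    *)
(* basis vectors in S. A lift of the holonomy must send s_i, s_j to scalar    *)
(* multiples of e_{S_i}, e_{S_j}, which commute because S_i and S_j are even  *)
(* and disjoint; by crev, the lift of s_j squares to (-1)^C(2l, 2) = (-1)^l.  *)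
(* The only relation this can violate is s_i s_j s_i^-1 = s_j^-1, which holds *)
(* exactly when a_ij = 1. Conversely, 2 b_i and (up to sign when a_ij = 1)    *)
(* 2 b_j are additive integer coordinates of (B, b) in the group, and         *)
(* (B, b) |-> e_{S_i}^(2 b_i) e_{S_j}^(2 b_j) is a lift.                      *)

Require Import Defs.
From mathcomp Require Import all_boot all_order all_algebra.
From mathcomp Require Import reals.
From mathcomp Require Import zify ring lra.

Set Implicit Arguments.
Unset Strict Implicit.
Unset Printing Implicit Defensive.

Import Order.TTheory GRing.Theory Num.Theory.
Local Open Scope ring_scope.

(** A Spin-structure is a choice of elements of Spin(n) over the holonomy of the generators,
    compatible with the relations of the group. Over the diagonal matrix with -1 exactly on an even
    set S, such an element is a multiple of e_S ([spin_cover_diag]), and e_S squares to (-1)^C(|S|,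
    2) ([cbase_sqr]). The lifts of s_i and s_j commute ([cbase_comm]), so the relation s_j s_i s_j =
    s_i, valid when a_ij = 1, forces the lift of s_j to square to 1; with |S_j| = 2l this excludes
    odd l ([no_spin_structure_rows]). In all other cases the coordinates of [bott_group_normal_form]
    give an explicit lift ([has_spin_structure_rows]). In the second arrangement, strict upper
    triangularity puts j to the left of the support of row i, so a_ij = 0 and there is no
    obstruction. *)

(** * Parities of cardinalities and binomials *)

Lemma odd_bin2_double m : odd 'C(2 * m, 2) = odd m.
Proof. by rewrite mul2n -addnn odd_bin2D addbb oddM andbb. Qed.

Lemma card_icc n a b : (b <= n)%N -> #|icc n a.+1 b| = (b - a)%N.
Proof.
move=> le_bn; rewrite -[RHS]muln1 -sum_nat_const_nat (big_nat_widen _ _ n) //.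
rewrite big_geq_mkord sum1_card; apply: eq_card => m.
by rewrite !inE unfold_in /= andbC.
Qed.

Lemma odd_card_symd n (S T : {set 'I_n}) :
  odd #|symd S T| = odd #|S| (+) odd #|T|.
Proof.
rewrite -(cardsID T S) -(cardsID S T) setIC /symd cardsU.
rewrite (_ : (S :\: T) :&: (T :\: S) = set0) ?cards0 ?subn0; last first.
  by apply/setP=> a; rewrite !inE; case: (a \in S); rewrite ?andbF.
by rewrite !oddD addbACA addbb.
Qed.

(** * Basis elements of the Clifford algebra and the elements of Spin(n) over diagonal matrices *)

Section CliffordBasis.
Variables (R : realType) (n : nat).
Implicit Types (S T : {set 'I_n}) (x y : clifford R n) (v : 'cV[R]_n).

(** Both parities are kept because the inductions build e_S one vector at a time, passing through
    odd products. *)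
Definition in_pin (b : bool) x : Prop :=
  exists s : seq 'cV[R]_n,
    [/\ forall v, v \in s -> unit_vec v, odd (size s) = b
      & x = \prod_(v <- s) cvec v].

Lemma in_spin_pin x : in_spin x <-> in_pin false x.
Proof.
split=> -[s [unit_s even_s ->]]; exists s; split=> //.
  exact: negPf.
by rewrite even_s.
Qed.

Lemma in_pin1 : in_pin false 1.
Proof. by exists [::]; rewrite big_nil. Qed.

Lemma in_pinM b c x y : in_pin b x -> in_pin c y -> in_pin (b (+) c) (x * y).
Proof.
move=> [s [unit_s <- ->]] [t [unit_t <- ->]]; exists (s ++ t); split.
- by move=> v; rewrite mem_cat => /orP[/unit_s|/unit_t].
- by rewrite size_cat oddD.
- by rewrite big_cat.
Qed.

Lemma in_pin_crev b x : in_pin b x -> in_pin b (crev x).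
Proof.
move=> [s [unit_s <- ->]]; exists (rev s); split.
- by move=> v; rewrite mem_rev => /unit_s.
- by rewrite size_rev.
- elim: s {unit_s} => [|v s IHs]; first by rewrite !big_nil crev1.
  by rewrite big_cons crevM crev_cvec IHs rev_cons -cats1 big_cat big_seq1.
Qed.

Lemma unit_vec_delta (a : 'I_n) : unit_vec (delta_mx a 0 : 'cV[R]_n).
Proof.
rewrite /unit_vec (bigD1 a) //= big1 => [|b /negPf nba].
  by rewrite mxE !eqxx expr1n addr0.
by rewrite mxE nba expr0n.
Qed.

Lemma in_pin_cbase1 (a : 'I_n) : in_pin true (cbase R [set a]).
Proof.
exists [:: delta_mx a 0]; split=> //; last by rewrite big_seq1 cvec_delta.
by move=> v; rewrite inE => /eqP->; exact: unit_vec_delta.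
Qed.

Lemma cbase_sqr1 (a : 'I_n) : cbase R [set a] * cbase R [set a] = -1.
Proof. by rewrite cbaseM csign1 leqnn symdd scaleN1r. Qed.

(** The sign -1 is e_a e_a, two further unit vectors; this is why an index [a] must be supplied. *)
Lemma in_pinZsign (a : 'I_n) (c : bool) b x :
  in_pin b x -> in_pin b ((-1) ^+ c *: x).
Proof.
case: c => pin_x; last by rewrite expr0 scale1r.
rewrite expr1 scaleN1r -mulN1r -(cbase_sqr1 a) -[b]/((true (+) true) (+) b).
exact: in_pinM (in_pinM (in_pin_cbase1 a) (in_pin_cbase1 a)) pin_x.
Qed.

Lemma in_pin_cbase S : in_pin (odd #|S|) (cbase R S).
Proof.
have [m] := ubnP #|S|; elim: m S => // m IHm S; rewrite ltnS => leSm.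
have [->|[a aS]] := set_0Vmem S; first by rewrite cards0; exact: in_pin1.
have cardS := cardsD1 a S; rewrite aS add1n in cardS.
have defS : symd [set a] (S :\ a) = S.
  apply/setP=> b; rewrite in_symd !inE.
  by case: eqP => [->|]; rewrite ?aS.
have -> : cbase R S = (-1) ^+ csign [set a] (S :\ a) *:
    (cbase R [set a] * cbase R (S :\ a)).
  by rewrite cbaseM defS scalerA -signr_addb addbb scale1r.
apply: (in_pinZsign a); rewrite cardS -addn1 oddD addbC.
by apply: in_pinM; [exact: in_pin_cbase1 | apply: IHm; rewrite -cardS].
Qed.

Lemma in_spin_cbase S : ~~ odd #|S| -> in_spin (cbase R S).
Proof.
by move=> /negPf evS; apply/in_spin_pin; rewrite -evS; exact: in_pin_cbase.
Qed.

Lemma in_spin1 : in_spin (1 : clifford R n).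
Proof. exact/in_spin_pin/in_pin1. Qed.

Lemma in_spinM x y : in_spin x -> in_spin y -> in_spin (x * y).
Proof.
by move=> /in_spin_pin sx /in_spin_pin sy; apply/in_spin_pin/(in_pinM sx sy).
Qed.

Lemma in_spinX x m : in_spin x -> in_spin (x ^+ m).
Proof.
move=> sx; elim: m => [|m IHm]; first by rewrite expr0; exact: in_spin1.
by rewrite exprS; exact: in_spinM.
Qed.

Lemma crevK : involutive (@crev R n).
Proof.
by move=> x; apply/ffunP=> S; rewrite !ffunE mulrA -expr2 sqrr_sign mul1r.
Qed.

Lemma in_spinVl x : in_spin x -> crev x * x = 1.
Proof.
move=> /in_spin_pin/in_pin_crev/in_spin_pin/in_spinV.
by rewrite crevK.
Qed.

Lemma crev_cbase S : crev (cbase R S) = (-1) ^+ 'C(#|S|, 2) *: cbase R S.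
Proof.
apply/ffunP=> T; rewrite !ffunE /GRing.scale /=.
by case: eqP => [->|_] //; rewrite !mulr0.
Qed.

(** On Spin(n) [crev] is the inverse, and it multiplies e_S by this sign. *)
Lemma cbase_sqr S : ~~ odd #|S| ->
  cbase R S * cbase R S = (-1) ^+ 'C(#|S|, 2).
Proof.
move=> evS; have:= in_spinV (in_spin_cbase evS).
rewrite crev_cbase -scalerAr => /(congr1 ( *:%R ((-1) ^+ 'C(#|S|, 2)))).
rewrite scalerA -expr2 sqrr_sign scale1r => ->.
by rewrite -signr_odd -[in RHS]signr_odd; case: odd; rewrite ?scale1r ?scaleN1r.
Qed.

(** Moving e_a across e_S costs one sign per factor, except for e_a itself. *)
Lemma csign_comm1 S (a : 'I_n) :
  csign S [set a] (+) csign [set a] S = odd #|S| (+) (a \in S).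
Proof.
rewrite csignC cards1 addbF.
have [aS|aS] := boolP (a \in S).
  have -> : symd S [set a] = S :\ a.
    apply/setP=> b; rewrite in_symd !inE.
    by case: eqP => [->|]; rewrite ?aS ?addbF.
  rewrite [#|S|](cardsD1 a) aS add1n binS bin1 !oddD /=.
  by case: (odd 'C(_, _)); case: (odd #|_|).
have -> : symd S [set a] = a |: S.
  apply/setP=> b; rewrite in_symd !inE.
  by case: eqP => [->|]; rewrite ?(negPf aS) ?addbF.
by rewrite cardsU1 aS add1n binS bin1 !oddD; case: (odd 'C(_, _)); case: (odd #|_|).
Qed.

Lemma cbase_comm1 S (a : 'I_n) : ~~ odd #|S| ->
  cbase R S * cbase R [set a] =
  (-1) ^+ (a \in S) *: (cbase R [set a] * cbase R S).
Proof.
move=> /negPf evS; have := csign_comm1 S a; rewrite evS /= => sgn.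
by rewrite !cbaseM scalerA -signr_addb -sgn addbK symdC.
Qed.

(** Exchanging disjoint products takes |S| |T| transpositions, an even number. *)
Lemma cbase_comm S T : ~~ odd #|S| -> ~~ odd #|T| -> [disjoint S & T] ->
  GRing.comm (cbase R S) (cbase R T).
Proof.
move=> evS evT disST; rewrite /GRing.comm !cbaseM (symdC T); congr (_ ^+ _ *: _).
have symdST : symd S T = S :|: T.
  apply/setP=> a; rewrite in_symd inE.
  by case: (boolP (a \in S)) => //= aS; rewrite (disjointFr disST aS).
have:= csignC S T; rewrite symdST cardsU (disjoint_setI0 disST) cards0 subn0.
rewrite odd_bin2D oddM (negPf evS) addbF addbb.
by case: csign; case: csign.
Qed.

Lemma cvec_inj : injective (@cvec R n).
Proof. by move=> v w eq_vw; apply/colP=> a; rewrite -!cvec1 eq_vw. Qed.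

Lemma spin_coverM x y : in_spin x -> in_spin y ->
  spin_cover (x * y) = spin_cover x *m spin_cover y.
Proof.
move=> sx sy; apply/matrixP=> a b.
have mul_delta (M : 'M[R]_n) : M a b = (M *m delta_mx b 0 : 'cV_n) a 0.
  by rewrite -colE mxE.
rewrite !mul_delta; congr (fun_of_matrix _ a 0); apply: cvec_inj.
rewrite -mulmxA -!spin_coverE //; last exact: in_spinM.
by rewrite crevM !mulrA.
Qed.

Lemma spin_cover1 : spin_cover (1 : clifford R n) = 1%:M.
Proof.
apply/matrixP=> a b; rewrite !mxE crev1 mul1r mulr1 cvec1 mxE.
by rewrite andbT.
Qed.

(** Conjugation by e_S, with |S| even, negates e_a exactly for a in S. *)
Lemma spin_cover_cbaseX S m : ~~ odd #|S| ->
  spin_cover (cbase R S ^+ m) = diag_mx (\row_a (-1) ^+ (odd m && (a \in S))).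
Proof.
move=> evS; have sS := in_spin_cbase evS.
elim: m => [|m IHm].
  by rewrite expr0 spin_cover1; apply/matrixP=> a b; rewrite !mxE.
rewrite exprS spin_coverM //; last exact: in_spinX.
have -> : spin_cover (cbase R S) = diag_mx (\row_a (-1) ^+ (a \in S)).
  apply/matrixP=> a b; rewrite mxE cvec_delta cbase_comm1 // -scalerAl -mulrA.
  rewrite in_spinV // mulr1 !ffunE !mxE (inj_eq set1_inj) /GRing.scale /=.
  by case: eqP => [->|]; rewrite ?mulr1 ?mulr0.
rewrite IHm mulmx_diag; congr diag_mx; apply/rowP=> a; rewrite !mxE -signr_addb /=.
by case: (a \in S); case: (odd m).
Qed.

(** The Clifford algebra is graded by parity: each vector factor flips the parity of every S that
    occurs. *)
Lemma in_pin_parity b x S : in_pin b x -> x S != 0 -> odd #|S| = b.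
Proof.
move=> [s [_ <- ->]]; elim: s S => [|v s IHs] S.
  by rewrite big_nil ffunE; have [->|_] := eqVneq S set0; rewrite ?cards0 ?eqxx.
rewrite big_cons; apply: contraNeq => odd_S; rewrite ffunE big1 // => T _.
rewrite sum_ffunE -mulrA mulr_suml mulr_sumr big1 // => a _.
rewrite !ffunE; case: eqP => [Ta|_]; last by rewrite /GRing.scale /= !(mulr0, mul0r).
have [->|/IHs] := eqVneq ((\prod_(v <- s) cvec v) (symd T S)) 0.
  by rewrite !mulr0.
rewrite odd_card_symd Ta cards1 /= => odd_S'.
by move: odd_S; rewrite /= -odd_S' negbK eqxx.
Qed.

Lemma coef_mul_cbase x S T :
  (x * cbase R T) (symd S T) = (-1) ^+ csign S T * x S.
Proof.
rewrite ffunE (bigD1 S) //= big1 => [|U neqU].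
  by rewrite symdK ffunE eqxx mulr1 addr0.
rewrite ffunE; case: eqP => [eqT|_]; last by rewrite mulr0.
have UT : symd U T = symd S T by rewrite -[in LHS]eqT symdK.
by case/eqP: neqU; rewrite -[U](symdK T) (symdC T U) UT (symdC S) symdK.
Qed.

Lemma coef_cbase_mul x S T :
  (cbase R T * x) (symd T S) = (-1) ^+ csign T S * x S.
Proof.
rewrite ffunE (bigD1 T) //= big1 => [|U /negPf neqU].
  by rewrite symdK ffunE eqxx mulr1 addr0.
by rewrite ffunE neqU mulr0 mul0r.
Qed.

(* Comparing coefficients in x e_a = +- e_a x for all a leaves e_S only,      *)
(* since the elements of Spin(n) are even.                                    *)
Lemma spin_cover_diag x S : ~~ odd #|S| -> in_spin x ->
  spin_cover x = diag_mx (\row_a (-1) ^+ (a \in S)) -> x = x S *: cbase R S.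
Proof.
move=> evS sx coverx; apply/ffunP=> T; rewrite !ffunE /GRing.scale /=.
have [->|neqTS] := eqVneq T S; first by rewrite mulr1.
rewrite mulr0; apply/eqP; apply/negPn/negP => xT; move: neqTS; apply/negP/negPn.
have evT := in_pin_parity (iffLR (in_spin_pin x) sx) xT.
apply/eqP/setP=> a; have comm_xa : x * cbase R [set a] =
    (-1) ^+ (a \in S) *: (cbase R [set a] * x).
  have := spin_coverE (delta_mx a 0) sx; rewrite coverx cvec_delta.
  have -> : diag_mx (\row_a (-1) ^+ (a \in S)) *m delta_mx a 0 =
      (-1) ^+ (a \in S) *: delta_mx a 0 :> 'cV[R]_n.
    by apply/colP=> b; rewrite mul_diag_mx !mxE; case: eqP => [->|]; rewrite ?mulr0.
  rewrite linearZ /= cvec_delta => /(congr1 ( *%R^~ x)).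
  by rewrite -mulrA in_spinVl // mulr1 scalerAl.
(* Both sides have coefficient +-x_T here; as x_T is non-zero the signs agree, so a lies in T iff it
   lies in S. *)
have := congr1 (fun y : clifford R n => y (symd T [set a])) comm_xa.
rewrite coef_mul_cbase ffunE (symdC T) coef_cbase_mul /GRing.scale /=.
have := csign_comm1 T a; rewrite evT /= => <-.
rewrite mulrA -signr_addb => /(mulIf xT)/eqP; rewrite (inj_eq signr_inj) => /eqP->.
by rewrite -addbA addbb addbF.
Qed.

End CliffordBasis.

(** * Integer exponents modulo 4 *)

(** For |S| even e_S has fourth power 1, so residues modulo 4 serve as exponents and negative powers
    are avoided. *)
Definition mod4 (z : int) : nat := `|(z %% 4)%Z|%N.

Lemma mod4D y z : mod4 (y + z) = ((mod4 y + mod4 z) %% 4)%N.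
Proof. by rewrite /mod4; lia. Qed.

Lemma odd_mod4D y z : odd (mod4 (y + z)) = odd (mod4 y) (+) odd (mod4 z).
Proof. by rewrite mod4D odd_mod // oddD. Qed.

Lemma odd_mod4N z : odd (mod4 (- z)) = odd (mod4 z).
Proof. by apply/eqP; rewrite -negb_add -odd_mod4D addNr. Qed.

Lemma odd_mod4_sign (b : bool) z : odd (mod4 ((-1) ^+ b * z)) = odd (mod4 z).
Proof. by case: b; rewrite ?expr0 ?mul1r // expr1 mulN1r odd_mod4N. Qed.

Lemma expr_mod4D (R : nzRingType) (x : R) y z : x ^+ 4 = 1 ->
  x ^+ mod4 (y + z) = x ^+ mod4 y * x ^+ mod4 z.
Proof. by move=> x4; rewrite mod4D expr_mod // exprD. Qed.

(** Absorbs the sign that a_ij = 1 introduces into the coordinate j of a product. *)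
Lemma expr_mod4_sign (R : nzRingType) (x : R) (b : bool) z :
  (b -> x ^+ 2 = 1) -> x ^+ mod4 ((-1) ^+ b * z) = x ^+ mod4 z.
Proof.
case: b => [/(_ isT) x2|_]; last by rewrite expr0 mul1r.
by rewrite -[LHS](expr_mod _ x2) -[RHS](expr_mod _ x2) !modn2 (odd_mod4_sign true).
Qed.

Lemma lin_partM (R : realType) n (g h : isom R n) :
  lin_part (g * h)%g = lin_part g *m lin_part h.
Proof. by []. Qed.

Lemma trans_partM (R : realType) n (g h : isom R n) :
  trans_part (g * h)%g = trans_part g + lin_part g *m trans_part h.
Proof. by []. Qed.

Lemma lin_partV (R : realType) n (g : isom R n) : lin_part g^-1%g = (lin_part g)^T.
Proof. by []. Qed.

Lemma trans_partV (R : realType) n (g : isom R n) :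
  trans_part g^-1%g = - ((lin_part g)^T *m trans_part g).
Proof. by []. Qed.

(** * Matrices with two non-zero rows: construction and obstruction *)

Section TwoRows.
Variables (R : realType) (n : nat) (A : 'M[bool]_n) (i j : 'I_n).
Hypotheses (upA : strictly_upper A) (lt_ij : (i < j)%N).
Hypothesis rowsA : forall r s, A r s -> r = i \/ r = j.

Definition row_supp (r : 'I_n) : {set 'I_n} := [set s | A r s].

Local Notation Si := (row_supp i).
Local Notation Sj := (row_supp j).
Hypotheses (evSi : ~~ odd #|Si|) (evSj : ~~ odd #|Sj|).

Local Notation u := (cbase R Si).
Local Notation v := (cbase R Sj).

Let Aii : A i i = false.
Proof. by apply/negP => /upA; rewrite ltnn. Qed.

Let Ajj : A j j = false.
Proof. by apply/negP => /upA; rewrite ltnn. Qed.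

Let Aji : A j i = false.
Proof. by apply/negP => /upA; rewrite ltnNge ltnW. Qed.

Definition row_sign (a b : bool) (m : 'I_n) : bool :=
  (a && A i m) (+) (b && A j m).

(** Since a_ii = a_ji = a_jj = 0, holonomy fixes coordinate i and acts on coordinate j only through
    a_ij, so both stay half-integers; their parities count s_i and s_j modulo 2, which determines
    the linear part. *)
Lemma bott_group_normal_form g : bott_group R A g -> exists y z : int,
  [/\ trans_part g i 0 = y%:~R / 2, trans_part g j 0 = z%:~R / 2
    & lin_part g =
        diag_mx (\row_m (-1) ^+ row_sign (odd (mod4 y)) (odd (mod4 z)) m)].
Proof.
elim=> [|r|{}g h _ [y [z [gi gj lg]]] _ [y' [z' [hi hj lh]]]|{}g _ [y [z [gi gj lg]]]].
- exists 0, 0; split; rewrite ?mul0r ?mxE //.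
  by apply/matrixP=> a b; rewrite !mxE.
- exists (i == r)%:R, (j == r)%:R; split.
  + by rewrite !mxE eqxx andbT mulrC; case: eqP.
  + by rewrite !mxE eqxx andbT mulrC; case: eqP.
  rewrite /lin_part /= /bott_diag; congr diag_mx; apply/rowP=> m.
  rewrite !mxE; congr (_ ^+ _); rewrite /row_sign.
  have [<-|nir] := eqVneq i r.
    by rewrite -val_eqE /= gtn_eqF //= addbF.
  have [<-|njr] := eqVneq j r; first by [].
  (* A generator other than s_i and s_j has a zero row, hence is a pure translation. *)
  rewrite /=; apply/eqP; rewrite eqb0; apply/negP => /rowsA[] eqr.
    by rewrite eqr eqxx in nir.
  by rewrite eqr eqxx in njr.
(* The sign is the action of the linear part of [g] on coordinate j. *)
- exists (y + y'), (z + (-1) ^+ (odd (mod4 y) && A i j) * z'); split.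
  + rewrite trans_partM lg mul_diag_mx !mxE gi hi /row_sign Aii Aji.
    by rewrite !andbF expr0 rmorphD; field.
  + rewrite trans_partM lg mul_diag_mx !mxE gj hj /row_sign Ajj.
    by rewrite !andbF addbF rmorphD rmorphM rmorphXn rmorphN1; field.
  rewrite lin_partM lg lh mulmx_diag; congr diag_mx.
  apply/rowP=> m; rewrite !mxE -signr_addb /row_sign !odd_mod4D odd_mod4_sign.
  congr (_ ^+ nat_of_bool _); case: (A i m); case: (A j m); rewrite ?andbT ?andbF ?addbF //=.
  by rewrite addbACA.
- exists (- y), (- ((-1) ^+ (odd (mod4 y) && A i j) * z)); split.
  + rewrite trans_partV lg tr_diag_mx mul_diag_mx !mxE gi /row_sign Aii Aji.
    by rewrite !andbF expr0 rmorphN; field.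
  + rewrite trans_partV lg tr_diag_mx mul_diag_mx !mxE gj /row_sign Ajj.
    by rewrite !andbF addbF rmorphN rmorphM rmorphXn rmorphN1; field.
  rewrite lin_partV lg tr_diag_mx; congr diag_mx.
  by apply/rowP=> m; rewrite !mxE !odd_mod4N odd_mod4_sign.
Qed.

(** The coordinate j is additive only up to a sign when a_ij = 1; the parity hypothesis then gives
    [v ^+ 2 = 1], so the sign is invisible in powers of [v]. *)
Lemma has_spin_structure_rows : [disjoint Si & Sj] ->
  (A i j -> ~~ odd 'C(#|Sj|, 2)) -> has_spin_structure (bott_group R A).
Proof.
move=> disS hv.
have pow4 (S : {set 'I_n}) : ~~ odd #|S| -> cbase R S ^+ 4 = 1.
  by move=> evS; rewrite (exprM _ 2 2) (expr2 (cbase R S)) cbase_sqr // sqrr_sign.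
have [u4 v4] := (pow4 _ evSi, pow4 _ evSj).
have v2 : A i j -> v ^+ 2 = 1.
  by move=> /hv evC; rewrite expr2 cbase_sqr // -signr_odd (negPf evC).
have su := in_spin_cbase R evSi; have sv := in_spin_cbase R evSj.
(* The floor makes the exponent defined on all isometries; on the group its argument is already an
   integer. *)
pose coord (g : isom R n) m := mod4 (Num.floor (2 * trans_part g m 0)).
have coordE (g : isom R n) m (z : int) :
    trans_part g m 0 = z%:~R / 2 -> coord g m = mod4 z.
  move=> gm; rewrite /coord gm mulrC divfK ?pnatr_eq0 //.
  by rewrite intrKfloor.
exists (fun g => u ^+ coord g i * v ^+ coord g j); split=> [g _|g h Gg Gh|g Gg].
- by apply: in_spinM; apply: in_spinX.
- have [y [z [gi gj lg]]] := bott_group_normal_form Gg.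
  have [y' [z' [hi hj _]]] := bott_group_normal_form Gh.
  have ghi : trans_part (g * h)%g i 0 = (y + y')%:~R / 2.
    rewrite trans_partM lg mul_diag_mx !mxE gi hi /row_sign Aii Aji.
    by rewrite !andbF expr0 rmorphD; field.
  have ghj : trans_part (g * h)%g j 0 =
      (z + (-1) ^+ (odd (mod4 y) && A i j) * z')%:~R / 2.
    rewrite trans_partM lg mul_diag_mx !mxE gj hj /row_sign Ajj.
    by rewrite !andbF addbF rmorphD rmorphM rmorphXn rmorphN1; field.
  rewrite (coordE _ _ _ ghi) (coordE _ _ _ ghj) (coordE _ _ _ gi) (coordE _ _ _ gj).
  rewrite (coordE _ _ _ hi) (coordE _ _ _ hj) !expr_mod4D // expr_mod4_sign; last first.
    by case/andP=> _ /v2.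
  rewrite -!mulrA; congr (_ * _); rewrite !mulrA; congr (_ * _).
  by apply: commrX; apply/commr_sym/commrX/commr_sym/cbase_comm.
have [y [z [gi gj ->]]] := bott_group_normal_form Gg.
rewrite (coordE _ _ _ gi) (coordE _ _ _ gj) spin_coverM; try exact: in_spinX.
rewrite !spin_cover_cbaseX // mulmx_diag; congr diag_mx; apply/rowP=> m.
by rewrite !mxE -signr_addb !inE.
Qed.

(* If j lies in row i then s_j s_i s_j = s_i, while the lifts of s_i and s_j  *)
(* commute and the latter squares to -1.                                      *)
Lemma no_spin_structure_rows : [disjoint Si & Sj] ->
  A i j -> odd 'C(#|Sj|, 2) -> ~ has_spin_structure (bott_group R A).
Proof.
move=> disS Aij oddC [eps [spin_eps morph_eps cover_eps]].
have Gi : bott_group R A (bott_gen R A i) by constructor.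
have Gj : bott_group R A (bott_gen R A j) by constructor.
have rel : (bott_gen R A j * bott_gen R A i * bott_gen R A j)%g = bott_gen R A i.
  apply: isom_eq.
    rewrite !lin_partM /lin_part /= /bott_diag !mulmx_diag.
    congr diag_mx; apply/rowP=> m; rewrite !mxE -!signr_addb.
    by rewrite addbAC addbb.
  rewrite !trans_partM lin_partM /trans_part /lin_part /= /bott_diag.
  rewrite mulmx_diag !mul_diag_mx; apply/colP=> m; rewrite !mxE.
  have /negPf nji : j != i by rewrite -val_eqE /= gtn_eqF.
  have [->|_] := eqVneq m j; first by rewrite Ajj Aij nji /= expr0 expr1; lra.
  have [->|_] := eqVneq m i; first by rewrite Aji /= expr0; lra.
  by rewrite /=; lra.
have lift r : bott_group R A (bott_gen R A r) -> ~~ odd #|row_supp r| ->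
    exists c, eps (bott_gen R A r) = c *: cbase R (row_supp r).
  move=> Gr evr; eexists; apply: spin_cover_diag => //; first exact: spin_eps.
  rewrite cover_eps // /lin_part /= /bott_diag; congr diag_mx.
  by apply/rowP=> m; rewrite !mxE inE.
have [c epsi] := lift i Gi evSi; have [d epsj] := lift j Gj evSj.
have := in_spinV (spin_eps _ Gj); rewrite epsj => dv.
(* The scalar d need not be known: [crev] inverts d v and also negates it. *)
have vv : (d *: v) * (d *: v) = -1.
  have crevE : crev (d *: v) = - (d *: v).
    apply/ffunP=> S; rewrite !ffunE; have [->|_] := eqVneq S Sj.
      by rewrite -signr_odd oddC expr1 mulN1r.
    by rewrite /GRing.scale /= !mulr0 oppr0.
  by rewrite -dv crevE mulrN opprK.
have comm_uv : (c *: u) * (d *: v) = (d *: v) * (c *: u).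
  rewrite -!scalerAl -!scalerAr !scalerA (mulrC d).
  by congr (_ *: _); exact: cbase_comm.
(* The relation becomes - c u = c u, so the lift of s_i is 0, which is not invertible. *)
have := congr1 eps rel; rewrite !morph_eps //; last by constructor.
rewrite epsi epsj -mulrA comm_uv mulrA vv mulN1r => /eqP.
rewrite eq_sym -addr_eq0 -mulr2n -scaler_nat scaler_eq0 pnatr_eq0 /= => /eqP cu0.
have := in_spinV (spin_eps _ Gi); rewrite epsi cu0 mul0r => /eqP.
by rewrite eq_sym oner_eq0.
Qed.

End TwoRows.

(** * The two arrangements of the supports *)

Theorem theorem3p1 (R : realType) (n : nat) (A : 'M[bool]_n) (i j : 'I_n)
    (k l i1 : nat) :
  strictly_upper A ->
  (i < j)%N ->
  (forall r : 'I_n, (exists s : 'I_n, A r s) <-> r = i \/ r = j) ->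
  orientable (bott_group R A) ->
  (forall r r' s : 'I_n, A r s -> A r' s -> r = r') ->
  (1 <= k)%N -> (1 <= l)%N -> (i1 + 2 * k + 2 * l <= n)%N ->
  ((forall m : 'I_n, A i m = (m \in icc n (i1 + 1) (i1 + 2 * k))) ->
   (forall r : 'I_n, A j r =
      (r \in icc n (i1 + 2 * k + 1) (i1 + 2 * k + 2 * l))) ->
   (has_spin_structure (bott_group R A) <->
    ~~ odd l \/ (odd l /\ j \notin icc n (i1 + 1) (i1 + 2 * k))))
  /\
  ((forall m : 'I_n, A j m = (m \in icc n (i1 + 1) (i1 + 2 * k))) ->
   (forall r : 'I_n, A i r =
      (r \in icc n (i1 + 2 * k + 1) (i1 + 2 * k + 2 * l))) ->
   has_spin_structure (bott_group R A)).
Proof.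
move=> upA lt_ij rowsA _ colA k_gt0 l_gt0 le_n.
have rows r s : A r s -> r = i \/ r = j by move=> Ars; apply/rowsA; exists s.
have disS : [disjoint row_supp A i & row_supp A j].
  apply/pred0P=> m /=; rewrite !inE; apply/negP => /andP[Aim Ajm].
  by rewrite (colA _ _ _ Aim Ajm) ltnn in lt_ij.
have card1 : #|icc n (i1 + 1) (i1 + 2 * k)| = (2 * k)%N.
  by rewrite addn1 card_icc ?addKn //; lia.
have card2 : #|icc n (i1 + 2 * k + 1) (i1 + 2 * k + 2 * l)| = (2 * l)%N.
  by rewrite addn1 card_icc ?addKn.
have suppE r (S : {set 'I_n}) : (forall m, A r m = (m \in S)) -> row_supp A r = S.
  by move=> ArE; apply/setP=> m; rewrite inE.
split=> [Ai Aj|Aj Ai].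
- have cardi : #|row_supp A i| = (2 * k)%N by rewrite (suppE _ _ Ai).
  have cardj : #|row_supp A j| = (2 * l)%N by rewrite (suppE _ _ Aj).
  have evi : ~~ odd #|row_supp A i| by rewrite cardi oddM.
  have evj : ~~ odd #|row_supp A j| by rewrite cardj oddM.
  rewrite -Ai; split=> [spinA|spin_cond].
    have [odd_l|] := boolP (odd l); last by left.
    right; split=> //; apply/negP => Aij.
    apply: (no_spin_structure_rows upA lt_ij) spinA => //.
    by rewrite cardj odd_bin2_double.
  apply: (has_spin_structure_rows R upA lt_ij rows) => // Aij.
  rewrite cardj odd_bin2_double.
  by case: spin_cond => // -[_]; rewrite Aij.
- apply: (has_spin_structure_rows R upA lt_ij rows) => //.
  + by rewrite (suppE _ _ Ai) card2 oddM.
  + by rewrite (suppE _ _ Aj) card1 oddM.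
  (* The ordinal i1 is the first column of the support of row j, so j < i1, whereas the support of
     row i starts further right; hence a_ij = 0. *)
  have lt_i1n : (i1 < n)%N by lia.
  have /upA /= : A j (Ordinal lt_i1n) by rewrite Aj inE /=; lia.
  by rewrite Ai inE; lia.
Qed.
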